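(* Let $K$ be a field, $S=K[x_1,\ldots,x_n]$ and let $I,J\subset S$ be two strongly stable ideals. Then $IJ$ is a strongly stable ideal and \[ \operatorname{sat}(IJ)\leq \operatorname{sat}(I)+\operatorname{sat}(J). \] If $I$ and $J$ are equigenerated, then $\operatorname{sat}(IJ)=\operatorname{sat}(I)+\operatorname{sat}(J)$.
   Context: $\mathfrak m=(x_1,\ldots,x_n)$. For a monomial ideal $I$, $G(I)$ is its unique minimal set of monomial generators. A monomial ideal $I$ is strongly stable if for all $u\in G(I)$ and all $i<j$ with $x_j\mid u$ one has $x_iu/x_j\in I$. A monomial ideal is equigenerated if all its minimal monomial generators have the same degree (the degree may be different for $I$ and $J$). For a graded ideal $I\subset S$, the saturation number is $\operatorname{sat}(I)=\min\{k\ge 0: I:\mathfrak m^k=I:\mathfrak m^{k+1}\}$.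
   Formalization: In the equality for equigenerated ideals, I and J are assumed nonzero: the zero ideal is vacuously strongly stable and equigenerated, and for I = 0, J = m (n ≥ 1) one has sat(IJ) = 0 but sat(I) + sat(J) = 1. *)

(* Defs.v *)
From HB Require Import structures.
From mathcomp Require Import all_boot all_order all_algebra.
From mathcomp Require Import boolp classical_sets.
From mathcomp Require Import mpoly.

Set Implicit Arguments.
Unset Strict Implicit.
Unset Printing Implicit Defensive.

Import GRing.Theory.

Local Open Scope classical_set_scope.
Local Open Scope ring_scope.

Section Ideals.
Variable R : comNzRingType.
Implicit Types (I J A : set R) (k : nat).

Definition is_ideal I : Prop :=
  [/\ I 0, (forall p q, I p -> I q -> I (p + q))
    & (forall a p, I p -> I (a * p))].

Definition ideal_gen A : set R := smallest is_ideal A.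

Definition ideal_mul I J : set R :=
  ideal_gen [set r | exists p q, [/\ I p, J q & r = p * q]].

(* I^0 is the unit ideal. *)
Definition ideal_exp I k : set R := iter k (ideal_mul I) setT.

Definition colon I J : set R := [set p | forall q, J q -> I (p * q)].

End Ideals.

Section MonomialIdeals.
Variables (K : fieldType) (n : nat).
Implicit Types (I J : set {mpoly K[n]}) (A B : set 'X_{1..n}).

Definition irrelevant_ideal : set {mpoly K[n]} :=
  ideal_gen [set p | exists i : 'I_n, p = 'X_i].

Definition mono_ideal A : set {mpoly K[n]} :=
  ideal_gen [set p | exists2 u, A u & p = 'X_[u]].

Definition is_monomial I : Prop := exists A, I = mono_ideal A.

Definition min_mono_gens I A : Prop :=
  I = mono_ideal A /\ forall B, B `<=` A -> I = mono_ideal B -> B = A.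

(* G(I), as a set of exponent vectors.  For a monomial ideal I exactly one A
   satisfies min_mono_gens I A (lemmas min_mono_gens_mgens and
   min_mono_gens_unique below), so the default value set0 is irrelevant. *)
Definition mgens I : set 'X_{1..n} := xget set0 [set A | min_mono_gens I A].

(* The subtraction of exponent vectors is exact here, since x_j divides u. *)
Definition strongly_stable I : Prop :=
  is_monomial I /\
  forall u : 'X_{1..n}, mgens I u ->
  forall i j : 'I_n, (i < j)%N -> (0 < u j)%N ->
    I 'X_[(U_(i) + u - U_(j))%MM].

(* Vacuously true of the zero ideal, which has no monomial generator. *)
Definition equigenerated I : Prop :=
  is_monomial I /\
  forall u v : 'X_{1..n}, mgens I u -> mgens I v -> mdeg u = mdeg v.

Definition sat_at I (k : nat) : Prop :=
  colon I (ideal_exp irrelevant_ideal k) =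
  colon I (ideal_exp irrelevant_ideal k.+1).

(* The least k such that sat_at I k.  For an ideal I such a k exists, the ring
   being Noetherian, so the default value 0 is irrelevant. *)
Definition sat I : nat :=
  xget 0%N [set k | sat_at I k /\ forall l, sat_at I l -> (k <= l)%N].

#[local] Hint Resolve lepm_refl : core.

Lemma ideal_gen_ideal (A : set {mpoly K[n]}) : is_ideal (ideal_gen A).
Proof.
split.
- by move=> I [[]].
- move=> p q Ap Aq I HI; have [[_ HD _] _] := HI.
  by apply: HD; [apply: Ap|apply: Aq].
- move=> a p Ap I HI; have [[_ _ HM] _] := HI.
  by apply: HM; apply: Ap.
Qed.

Lemma mono_ideal_msupp A (p : {mpoly K[n]}) :
  mono_ideal A p -> forall m, m \in msupp p -> exists2 a, A a & (a <= m)%MM.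
Proof.
set Q := [set p : {mpoly K[n]} |
  forall m, m \in msupp p -> exists2 a, A a & (a <= m)%MM].
suff QI : is_ideal Q /\ [set p | exists2 u, A u & p = 'X_[u]] `<=` Q.
  by move=> /(_ Q QI).
split; last by move=> _ [u Au ->] m; rewrite msuppX inE => /eqP ->; exists u.
split.
- by move=> m; rewrite msupp0.
- by move=> q r Qq Qr m /msuppD_le; rewrite mem_cat => /orP[/Qq|/Qr].
- move=> q r Qr m /msuppM_le /allpairsP[[m1 m2] /= [_ /Qr[a Aa le_am] ->]].
  by exists a => //; apply: lepm_trans le_am (lem_addl _ _).
Qed.

Lemma mono_ideal_leX A (a m : 'X_{1..n}) :
  A a -> (a <= m)%MM -> mono_ideal A 'X_[m].
Proof.
move=> Aa le_am I [[_ _ HM] HA].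
by rewrite -(submK le_am) mpolyXD; apply: HM; apply: HA; exists a.
Qed.

Lemma mono_idealP A (m : 'X_{1..n}) :
  mono_ideal A 'X_[m] <-> exists2 a, A a & (a <= m)%MM.
Proof.
split=> [/mono_ideal_msupp/(_ m)|[a]]; last exact: mono_ideal_leX.
by rewrite msuppX inE; apply.
Qed.

Lemma mono_idealS A B :
  (forall a, A a -> exists2 b, B b & (b <= a)%MM) ->
  mono_ideal A `<=` mono_ideal B.
Proof.
move=> AB p; apply; split; first exact: ideal_gen_ideal.
by move=> _ [a /AB[b Bb le_ba] ->]; apply: mono_ideal_leX le_ba.
Qed.

Lemma min_mono_gensE I A : min_mono_gens I A ->
  A = [set u | I 'X_[u] /\ forall v, I 'X_[v] -> (v <= u)%MM -> v = u].
Proof.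
move=> [-> Amin]; apply/seteqP; split=> u /=; last first.
  move=> [/mono_idealP[a Aa le_au] umin].
  by rewrite -(umin a) //; apply/mono_idealP; exists a.
move=> Au; split=> [|v /mono_idealP[a Aa le_av] le_vu].
  by apply/mono_idealP; exists u.
have le_au := lepm_trans le_av le_vu.
have [eq_au|ne_au] := eqVneq a u.
  apply/mnmP => i; apply/eqP; rewrite eqn_leq (mnm_lepP le_vu).
  by rewrite -eq_au (mnm_lepP le_av).
have BA : [set w | A w /\ w <> u] `<=` A by move=> w [].
suff /(Amin _ BA)/seteqP[_ /(_ u Au)[_ /(_ erefl)]] :
  mono_ideal A = mono_ideal [set w | A w /\ w <> u] by [].
apply/seteqP; split; apply: mono_idealS => w; last by case=> Aw _; exists w.
move=> Aw; have [->|/eqP ne_wu] := eqVneq w u; last by exists w.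
by exists a => //; split=> //; apply/eqP.
Qed.

Lemma min_mono_gens_unique I A B :
  min_mono_gens I A -> min_mono_gens I B -> A = B.
Proof. by move=> /min_mono_gensE -> /min_mono_gensE ->. Qed.

Lemma min_mono_gens_mgens I : is_monomial I -> min_mono_gens I (mgens I).
Proof.
move=> [A ->]; apply: (xgetPex set0 (P := [set B | min_mono_gens _ B])).
pose B := [set u | A u /\ forall v, A v -> (v <= u)%MM -> v = u].
exists B => /=; split.
  apply/seteqP; split; apply: mono_idealS => u; last by case=> Au _; exists u.
  have [d] := ubnP (mdeg u); elim: d => // d IHd in u *; rewrite ltnS => led Au.
  have [Bu|/not_andP[]// /existsNP[v /not_implyP[Av /not_implyP[le_vu ne_vu]]]] :=
    pselect (B u); first by exists u.
  have [|w Bw le_wv] := IHd v _ Av; last by exists w => //; apply: lepm_trans le_vu.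
  apply: leq_trans led; rewrite -(submK le_vu) mdegD -[X in (X < _)%N]add0n.
  rewrite ltn_add2r lt0n mdeg_eq0; apply/eqP => eq0; apply: ne_vu.
  by rewrite -[RHS](submK le_vu) eq0 add0m.
move=> C CB eqI; apply/seteqP; split=> // u [Au umin].
have /mono_idealP[c Cc le_cu] : mono_ideal C 'X_[u].
  by rewrite -eqI; apply/mono_idealP; exists u.
by rewrite -(umin c) //; have [] := CB c Cc.
Qed.

End MonomialIdeals.

(* Main.v *)
(** For a strongly stable ideal [I], the monomials [u] such that [u * m^k] lies
    in [I] are those such that [u * x_n^k] does.  Hence [sat I] is the least [k]
    such that every monomial of [I] whose exponent of [x_n] exceeds [k] can be
    divided by [x_n] within [I]; such a [k] exists by Dickson's lemma.  In a
    product of monomials of [I] and [J] whose exponent of [x_n] exceeds [k + l],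
    one factor has exponent exceeding [k], resp. [l]; this gives the inequality.
    In the equigenerated case, the product of two generators whose exponents of
    [x_n] are at least [sat I] and [sat J] has the least degree possible in [IJ],
    so it cannot be divided by [x_n] within [IJ]. *)
Require Import Defs.
From mathcomp Require Import all_boot all_order all_algebra.
From mathcomp Require Import boolp classical_sets.
From mathcomp Require Import mpoly.

Local Open Scope classical_set_scope.
Local Open Scope ring_scope.

Set Implicit Arguments.
Unset Strict Implicit.
Unset Printing Implicit Defensive.

Import GRing.Theory.

(** * Dickson's lemma for sequences of exponent vectors *)

(** Each index is chosen where [f] is minimal over all indices past the previous one; minima over
    shrinking tails cannot decrease. *)
Lemma nondecreasing_subsequence (f : nat -> nat) :
  exists g : nat -> nat,
    {homo g : i j / (i < j)%N} /\ {homo f \o g : i j / (i <= j)%N}.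
Proof.
have argmin N : exists m, (N <= m)%N /\ forall p, (N <= p)%N -> (f m <= f p)%N.
  have ex : exists v, `[< exists2 m, (N <= m)%N & f m = v >].
    by exists (f N); apply/asboolP; exists N.
  case: (ex_minnP ex) => v /asboolP[m leNm <-] vmin.
  by exists m; split=> // p leNp; apply: vmin; apply/asboolP; exists p.
have [h hP] := choice argmin.
pose g := fix g k := if k is k'.+1 then h (g k').+1 else h 0%N.
have gS k : (g k < g k.+1)%N by have [] := hP (g k).+1.
exists g; split; first exact: (homo_ltn ltn_trans gS).
apply: (homo_leq leqnn leq_trans) => -[|k] /=.
  by have [_] := hP 0%N; apply.
have [_] := hP (g k).+1; apply; exact: ltn_trans (gS k) (gS k.+1).
Qed.

Lemma dickson_subsequence (n : nat) (f : nat -> 'X_{1..n}) :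
  exists g : nat -> nat, {homo g : i j / (i < j)%N} /\
    forall k l, (k <= l)%N -> (f (g k) <= f (g l))%MM.
Proof.
(* Stated over a list of coordinates, so that induction can thin out the sequence one coordinate at
   a time. *)
suff [g [gI gP]] : exists g : nat -> nat, {homo g : i j / (i < j)%N} /\
    forall i, i \in enum 'I_n -> forall k l, (k <= l)%N -> (f (g k) i <= f (g l) i)%N.
  exists g; split=> // k l lekl; apply/mnm_lepP => i.
  by apply: gP; rewrite // mem_enum.
elim: (enum _) => [|i s [g [gI gP]]]; first by exists id; split.
have [h [hI hP]] := nondecreasing_subsequence (fun k => f (g k) i).
exists (g \o h); split=> [k l ltkl|j]; first exact: gI (hI _ _ ltkl).
rewrite inE => /orP[/eqP -> k l|js k l lekl]; first exact: hP.
by apply: (gP j js); apply: (ltnW_homo hI).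
Qed.

(** * Monomial ideals and their products *)

Section MonomialIdeals.
Variables (K : fieldType) (n : nat).
Implicit Types (I J : set {mpoly K[n]}) (A B : set 'X_{1..n}).
Implicit Types (u v w a b : 'X_{1..n}) (p q : {mpoly K[n]}).

Lemma monomial_ideal I : is_monomial I -> is_ideal I.
Proof. by case=> A ->; apply: ideal_gen_ideal. Qed.

Lemma monomial_msupp I p : is_monomial I ->
  I p <-> forall u, u \in msupp p -> I 'X_[u].
Proof.
move=> mI; split=> [|Ip].
  by case: mI => [A ->] /mono_ideal_msupp Ap u /Ap/mono_idealP.
have [I0 ID IM] := monomial_ideal mI.
rewrite [p]mpolyE big_seq; elim/big_ind: _ => // u /Ip.
by rewrite -mul_mpolyC; apply: IM.
Qed.

Lemma monomial_mulX I u v : is_monomial I -> I 'X_[u] -> I 'X_[(u + v)%MM].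
Proof.
by move=> /monomial_ideal[_ _ IM] Iu; rewrite mpolyXD mulrC; apply: IM.
Qed.

Lemma monomial_le I u v : is_monomial I -> I 'X_[u] -> (u <= v)%MM -> I 'X_[v].
Proof. by move=> mI Iu /submK <-; rewrite addmC; apply: monomial_mulX. Qed.

Lemma monomial_mgens I u : is_monomial I ->
  I 'X_[u] <-> exists2 g, mgens I g & (g <= u)%MM.
Proof. by move=> /min_mono_gens_mgens[eqI _]; rewrite {1}eqI; apply: mono_idealP. Qed.

Lemma mgens_mem I u : is_monomial I -> mgens I u -> I 'X_[u].
Proof.
by move=> mI gu; apply/(monomial_mgens _ mI); exists u; last exact: lepm_refl.
Qed.

Lemma mdeg_gt0_le u : (0 < mdeg u)%N -> exists i : 'I_n, (U_(i) <= u)%MM.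
Proof.
move=> ugt0; apply: contrapT => /forallNP u0; move: ugt0.
rewrite mdegE big1 // => i _; apply/eqP.
by move/negP: (u0 i); rewrite lep1mP negbK.
Qed.

Lemma mdeg_subU u (i : 'I_n) k :
  (U_(i) <= u)%MM -> mdeg u = k.+1 -> mdeg (u - U_(i))%MM = k.
Proof. by move=> /submK {1}<-; rewrite mdegD mdeg1 addn1 => -[]. Qed.

(** Every monomial of [q * r] is a monomial of [q] times one of [r], hence a multiple of a product
    of two generators. *)
Lemma ideal_mul_mono A B :
  ideal_mul (mono_ideal A) (mono_ideal B) =
  mono_ideal [set u | exists a b, [/\ A a, B b & u = (a + b)%MM]]
    :> set {mpoly K[n]}.
Proof.
apply/seteqP; split=> p; apply; (split; first exact: ideal_gen_ideal).
  move=> _ [q [r [Aq Br ->]]]; apply/monomial_msupp; first by eexists.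
  move=> _ /msuppM_le/allpairsP[[u v] /= [uq vr ->]].
  have [a Aa leau] := mono_ideal_msupp Aq uq.
  have [b Bb lebv] := mono_ideal_msupp Br vr.
  apply/mono_idealP; exists (a + b)%MM; first by exists a, b.
  by apply/mnm_lepP => i; rewrite !mnmDE leq_add //; apply/mnm_lepP.
move=> _ [_ [a [b [Aa Bb ->]]] ->] L [_]; apply.
exists 'X_[a], 'X_[b]; split; last by rewrite mpolyXD.
- exact: mono_ideal_leX Aa (lepm_refl a).
- exact: mono_ideal_leX Bb (lepm_refl b).
Qed.

Lemma monomial_mono I : is_monomial I -> I = mono_ideal [set u | I 'X_[u]].
Proof.
case=> A ->; apply/seteqP; split; apply: mono_idealS => u.
  move=> Au; exists u => /=; last exact: lepm_refl.
  exact: mono_ideal_leX Au (lepm_refl u).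
by move=> /mono_idealP.
Qed.

Lemma is_monomial_mul I J :
  is_monomial I -> is_monomial J -> is_monomial (ideal_mul I J).
Proof. by move=> [A ->] [B ->]; rewrite ideal_mul_mono; eexists. Qed.

Lemma ideal_mul_monoP I J u : is_monomial I -> is_monomial J ->
  ideal_mul I J 'X_[u] <->
  exists a b, [/\ I 'X_[a], J 'X_[b] & u = (a + b)%MM].
Proof.
move=> mI mJ; split=> [|[a [b [Ia Jb ->]]]]; last first.
  by move=> L [_]; apply; exists 'X_[a], 'X_[b]; rewrite mpolyXD.
rewrite {1}(monomial_mono mI) {1}(monomial_mono mJ) ideal_mul_mono.
move=> /mono_idealP[_ [a [b [/= Ia Jb ->]]] leu].
(* The second factor absorbs the surplus of [u] over [a + b], which makes the factorisation
   exact. *)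
exists a, (b + (u - (a + b)))%MM; split=> //; first exact: monomial_mulX.
by rewrite addmA addmC submK.
Qed.

(** * Powers of the irrelevant ideal, colon ideals and the saturation number *)

Lemma irrelevant_exp k :
  ideal_exp (@irrelevant_ideal K n) k = mono_ideal [set w | mdeg w = k].
Proof.
have irrE : @irrelevant_ideal K n =
    mono_ideal [set w | exists i : 'I_n, w = U_(i)%MM].
  congr ideal_gen; apply/seteqP; split=> p /=.
    by move=> [i ->]; exists U_(i)%MM => //; exists i.
  by move=> [_ [i ->] ->]; exists i.
elim: k => [|k IHk].
  apply/seteqP; split=> // p _.
  apply/monomial_msupp; first by eexists.
  move=> u _; apply/mono_idealP; exists 0%MM; first exact: mdeg0.
  by apply/mnm_lepP => i; rewrite mnm0E.
rewrite /ideal_exp iterS -/(ideal_exp _ _) IHk irrE ideal_mul_mono.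
congr mono_ideal; apply/seteqP; split=> u /=.
  by move=> [_ [b [[i ->] degb ->]]]; rewrite mdegD mdeg1 degb.
move=> degu; have [|i leu] := @mdeg_gt0_le u; first by rewrite degu.
exists U_(i)%MM, (u - U_(i))%MM; rewrite addmC submK //; split=> //.
  by exists i.
exact: mdeg_subU.
Qed.

(** Multiplication by a monomial shifts the support without cancellation, so the colon ideal can be
    tested monomial by monomial. *)
Lemma colon_irrelevant I k p : is_monomial I ->
  colon I (ideal_exp (@irrelevant_ideal K n) k) p <->
  forall u, u \in msupp p -> forall w, mdeg w = k -> I 'X_[(u + w)%MM].
Proof.
move=> mI; rewrite irrelevant_exp; split=> [Ip u up w degw|Ip q Aq].
  have /Ip/(monomial_msupp _ mI) : mono_ideal [set w | mdeg w = k] ('X_[K, w]).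
    exact: mono_ideal_leX degw (lepm_refl w).
  by apply; rewrite addmC mcoeff_msupp mcoeffMX -mcoeff_msupp.
apply/(monomial_msupp _ mI) => _ /msuppM_le/allpairsP[[u v] /= [up vq ->]].
have [w /= degw /submK <-] := mono_ideal_msupp Aq vq.
by rewrite [(_ - _ + _)%MM]addmC addmA; apply: monomial_mulX => //; apply: Ip.
Qed.

Lemma sat_atP I k : is_monomial I -> sat_at I k <->
  forall u, (forall w, mdeg w = k.+1 -> I 'X_[(u + w)%MM]) ->
            forall w, mdeg w = k -> I 'X_[(u + w)%MM].
Proof.
move=> mI; rewrite /sat_at; split=> [eqI u Iu w degw|Isat].
  have : colon I (ideal_exp (@irrelevant_ideal K n) k) 'X_[u].
    rewrite eqI; apply/colon_irrelevant => // v.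
    by rewrite msuppX inE => /eqP ->.
  by move/(colon_irrelevant _ _ mI); apply=> //; rewrite msuppX inE.
apply/seteqP; split=> p /(colon_irrelevant _ _ mI) Ip; apply/colon_irrelevant => //.
  (* This inclusion holds for every [k]: a monomial of degree [k.+1] is a multiple of one of degree
     [k]. *)
  move=> u up w degw; have [|i lew] := @mdeg_gt0_le w; first by rewrite degw.
  rewrite -(submK lew) addmA; apply: monomial_mulX => //; apply: Ip => //.
  exact: mdeg_subU.
by move=> u up; apply: Isat => w degw; apply: Ip.
Qed.

Lemma sat_eq I k : sat_at I k -> (forall l, sat_at I l -> (k <= l)%N) ->
  sat I = k.
Proof.
move=> Ik kmin; apply: xget_unique => //= l [Il lmin].
by apply/eqP; rewrite eqn_leq lmin // kmin.
Qed.

(** By well-ordering, a single [k] with [sat_at I k] ensures that [sat I] is a true minimum and not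
    the default value. *)
Lemma satP I k : sat_at I k ->
  sat_at I (sat I) /\ forall l, sat_at I l -> (sat I <= l)%N.
Proof.
move=> Ik; have ex : exists l, `[< sat_at I l >] by exists k; apply/asboolP.
case: (ex_minnP ex) => l /asboolP Il lmin.
have {}lmin m : sat_at I m -> (l <= m)%N by move=> Im; apply/lmin/asboolP.
by rewrite (sat_eq Il lmin).
Qed.

(** * Strong stability and degrees of generators *)

Lemma strongly_stableP I : strongly_stable I <-> is_monomial I /\
  forall u, I 'X_[u] -> forall i j : 'I_n, (i < j)%N -> (0 < u j)%N ->
  I 'X_[(U_(i) + u - U_(j))%MM].
Proof.
split=> -[mI Is]; split=> // u; last first.
  by move=> gu; apply: Is; apply: mgens_mem.
move=> /(monomial_mgens _ mI)[g gg legu] i j ltij uj.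
(* If x_j divides the generator [g], the exchange is made in [g]; otherwise [g] itself still divides
   x_i u / x_j. *)
have [gj|] := boolP (0 < g j)%N.
  apply: (monomial_le mI (Is _ gg _ _ ltij gj)).
  apply/mnm_lepP => k; rewrite !mnmBE !mnmDE leq_sub2r // leq_add2l.
  exact/mnm_lepP.
rewrite -leqNgt leqn0 => /eqP gj.
have Ig := mgens_mem mI gg.
apply: (monomial_le mI Ig); apply/mnm_lepP => k; rewrite mnmBE mnmDE !mnm1E.
have [<-|_] := eqVneq j k; first by rewrite gj.
by rewrite subn0; apply: leq_trans (mnm_lepP legu k) (leq_addl _ _).
Qed.

(** If x_j divides a product, it divides one of the factors, and the exchange is made there. *)
Lemma strongly_stable_mul I J :
  strongly_stable I -> strongly_stable J -> strongly_stable (ideal_mul I J).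
Proof.
move=> /strongly_stableP[mI Is] /strongly_stableP[mJ Js].
apply/strongly_stableP; split=> [|u]; first exact: is_monomial_mul.
move=> /(ideal_mul_monoP _ mI mJ)[a [b [Ia Jb ->]]] i j ltij.
rewrite mnmDE addn_gt0 => /orP[aj|bj]; apply/ideal_mul_monoP => //.
  exists (U_(i) + a - U_(j))%MM, b; split=> //; first exact: Is.
  apply/mnmP => k; rewrite !(mnmBE, mnmDE) !mnm1E addnA addnBAC //.
  by case: eqVneq => [<-|//]; rewrite ltn_addl.
exists a, (U_(i) + b - U_(j))%MM; split=> //; first exact: Js.
apply/mnmP => k; rewrite !(mnmBE, mnmDE) !mnm1E addnCA addnBA //.
by case: eqVneq => [<-|//]; rewrite ltn_addl.
Qed.

Lemma equigenerated_mdeg I u v :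
  equigenerated I -> mgens I u -> I 'X_[v] -> (mdeg u <= mdeg v)%N.
Proof.
move=> [mI Ideg] gu /(monomial_mgens _ mI)[g gg /submK <-].
by rewrite mdegD (Ideg _ _ gu gg) leq_addl.
Qed.

Lemma monomial_neq0 I : is_monomial I -> I <> [set 0] -> exists u, I 'X_[u].
Proof.
move=> mI In0; apply: contrapT => /forallNP I0; apply: In0.
apply/seteqP; split=> p /=; last by move=> ->; have [] := monomial_ideal mI.
move=> /(monomial_msupp _ mI) Ip; apply/eqP; rewrite -msupp_eq0.
by case: (msupp p) Ip => // u s /(_ u); rewrite inE eqxx => /(_ isT)/I0.
Qed.

End MonomialIdeals.

(** * Saturation read off the exponent of the last variable x_n *)

Section LastVariable.
Variables (K : fieldType) (n : nat).
Implicit Types (I J : set {mpoly K[n.+1]}) (u v w : 'X_{1..n.+1}).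

(** With [n.+1] variables a last one, [ord_max], exists. For strongly stable [I] the condition
    amounts to [sat_at I k]. *)
Definition last_divisible I k := forall u,
  I 'X_[u] -> (k < u ord_max)%N -> I 'X_[(u - U_(ord_max))%MM].

(** The factors x_n beside [u] are exchanged one by one for the variables of [w]. *)
Lemma strongly_stable_irrelevant I u w : strongly_stable I ->
  I 'X_[(u + U_(ord_max) *+ mdeg w)%MM] -> I 'X_[(u + w)%MM].
Proof.
move=> /strongly_stableP[mI Is]; move degw: (mdeg w) => d.
elim: d u w degw => [|d IHd] u w degw.
  by move/eqP: degw; rewrite mdeg_eq0 mulm0n => /eqP ->.
have [|i lew] := @mdeg_gt0_le _ w; first by rewrite degw.
move=> Iu; rewrite -(submK lew) [(_ - _ + _)%MM]addmC addmA; apply: IHd.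
  exact: mdeg_subU.
have [ei|ni] := eqVneq i ord_max; first by rewrite ei -addmA -mulmS.
have lti : (i < @ord_max n)%N by rewrite ltn_neqAle ni -ltnS ltn_ord.
have := Is _ Iu _ _ lti; rewrite mulmS mnmDE mnmDE mnm1E eqxx addnCA.
move=> /(_ isT); congr (I 'X_[_]); apply/mnmP => k.
rewrite !(mnmBE, mnmDE).
by rewrite [(u k + (_ + _))%N]addnCA addnCA addKn addnCA addnA.
Qed.

Lemma sat_at_last I k : strongly_stable I -> sat_at I k <-> last_divisible I k.
Proof.
move=> sI; have [mI _] := sI; split=> [/(sat_atP _ mI) Isat u Iu ltk|Ik].
  have lek : (U_(ord_max) *+ k.+1 <= u)%MM.
    apply/mnm_lepP => i; rewrite mulmnE mnm1E.
    by case: eqVneq => [<-|]; rewrite ?mul1n ?mul0n.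
  (* With v the quotient of [u] by x_n^(k+1), the ideal contains v x_n^(k+1), hence v m^(k+1), hence
     v m^k, and so v x_n^k, which is [u] divided by x_n. *)
  have := Isat (u - U_(ord_max) *+ k.+1)%MM _ (U_(ord_max) *+ k)%MM.
  rewrite mdegMn mdeg1 mul1n => H.
  have <- : (u - U_(ord_max) *+ k.+1 + U_(ord_max) *+ k = u - U_(ord_max))%MM.
    by rewrite -{2}(submK lek) mulmSr addmA addmK.
  apply: H => // w degw; apply: strongly_stable_irrelevant => //.
  by rewrite degw submK.
apply/sat_atP => // u Iu w degw; apply: strongly_stable_irrelevant => //.
rewrite degw; have := Iu (U_(ord_max) *+ k.+1)%MM.
rewrite mdegMn mdeg1 mul1n => /(_ erefl)/Ik.
rewrite mulmSr addmA addmK; apply.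
by rewrite !mnmDE mulmnE mnm1E eqxx mul1n addn1 ltnS leq_addl.
Qed.

Lemma last_divisible_exists I : is_monomial I -> exists k, last_divisible I k.
Proof.
move=> mI; apply: contrapT => /forallNP In.
have /choice[f fP] k : exists u, [/\ I 'X_[u], (k < u ord_max)%N
    & ~ I 'X_[(u - U_(ord_max))%MM]].
  move: (In k) => /existsNP[u /not_implyP[Iu /not_implyP[ltk nI]]].
  by exists u.
have [g [gI gP]] := dickson_subsequence f.
have gid k : (k <= g k)%N.
  by elim: k => // k IHk; apply: leq_ltn_trans IHk (gI _ _ (ltnSn k)).
(* The exponent of x_n in [f (g N)] exceeds [g N], hence [N], so [f (g N)] divided by x_n is still a
   multiple of [f (g 0)]. *)
pose N := f (g 0%N) ord_max.
have [I0 _ _] := fP (g 0%N); have [_ ltN nI] := fP (g N).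
apply: nI; apply: (monomial_le mI I0); apply/mnm_lepP => i.
rewrite mnmBE mnm1E; case: eqVneq => [<-|_].
  by rewrite leq_subRL ?(leq_ltn_trans _ ltN) // add1n (leq_ltn_trans (gid N) ltN).
by rewrite subn0; apply/mnm_lepP/gP.
Qed.

Lemma sat_last I : strongly_stable I ->
  last_divisible I (sat I) /\ forall l, last_divisible I l -> (sat I <= l)%N.
Proof.
move=> sI; have [mI _] := sI.
have [k /(sat_at_last _ sI)/satP[Isat Imin]] := last_divisible_exists mI.
by split=> [|l Il]; [|apply: Imin]; apply/(sat_at_last _ sI).
Qed.

Lemma last_divisible_mul I J k l : is_monomial I -> is_monomial J ->
  last_divisible I k -> last_divisible J l ->
  last_divisible (ideal_mul I J) (k + l).
Proof.
move=> mI mJ Ik Jl _ /(ideal_mul_monoP _ mI mJ)[a [b [Ia Jb ->]]].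
rewrite mnmDE => ltkl; apply/ideal_mul_monoP => //.
have [lta|leak] := ltnP k (a ord_max).
  exists (a - U_(ord_max))%MM, b; split=> //; first exact: Ik.
  rewrite [RHS]addmC [(a + b)%MM]addmC addmBA // lep1mP -lt0n.
  exact: leq_ltn_trans lta.
have ltb : (l < b ord_max)%N.
  by rewrite ltnNge; apply/negP => lebl; move: ltkl; rewrite ltnNge leq_add.
exists a, (b - U_(ord_max))%MM; split=> //; first exact: Jl.
by rewrite addmBA // lep1mP -lt0n; apply: leq_ltn_trans ltb.
Qed.

(** Minimality of a positive [sat I] yields a monomial [u] of [I] with x_n-exponent at least [sat I]
    that cannot be divided by x_n within [I]. A generator dividing [u] with a smaller exponent would
    divide u / x_n. *)
Lemma mgens_last_sat I : strongly_stable I -> I <> [set 0] ->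
  exists2 g, mgens I g & (sat I <= g ord_max)%N.
Proof.
move=> sI In0; have [mI _] := sI; have [_ Imin] := sat_last sI.
case E: (sat I) => [|k].
  (* For saturation number 0 any generator will do; one exists because [I] is nonzero. *)
  by have [u /(monomial_mgens _ mI)[g]] := monomial_neq0 mI In0; exists g.
have /existsNP[u /not_implyP[Iu /not_implyP[ltk nI]]] : ~ last_divisible I k.
  by move=> /Imin; rewrite E ltnn.
have /(monomial_mgens _ mI)[g gg legu] := Iu; exists g => //.
rewrite ltnNge; apply/negP => legk; apply: nI.
have Ig := mgens_mem mI gg.
apply: (monomial_le mI Ig); apply/mnm_lepP => i; rewrite mnmBE mnm1E.
case: eqVneq => [<-|_]; last by rewrite subn0; apply/mnm_lepP.
by rewrite leq_subRL ?(leq_ltn_trans _ ltk) // add1n (leq_ltn_trans legk ltk).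
Qed.

Lemma sat_mul_le I J : strongly_stable I -> strongly_stable J ->
  (sat (ideal_mul I J) <= sat I + sat J)%N.
Proof.
move=> sI sJ; have [[mI _] [mJ _]] := (sI, sJ).
apply: (sat_last (strongly_stable_mul sI sJ)).2.
by apply: last_divisible_mul => //; apply: (sat_last _).1.
Qed.

Lemma sat_mul_ge I J : strongly_stable I -> strongly_stable J ->
  I <> [set 0] -> J <> [set 0] -> equigenerated I -> equigenerated J ->
  (sat I + sat J <= sat (ideal_mul I J))%N.
Proof.
move=> sI sJ In0 Jn0 eI eJ; have [[mI _] [mJ _]] := (sI, sJ).
have [u gu leu] := mgens_last_sat sI In0.
have [v gv lev] := mgens_last_sat sJ Jn0.
have Iu := mgens_mem mI gu.
have Jv := mgens_mem mJ gv.
rewrite leqNgt; apply/negP => ltsat.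
have ltuv : (sat (ideal_mul I J) < (u + v)%MM ord_max)%N.
  by rewrite mnmDE; apply: leq_trans ltsat (leq_add leu lev).
have IJuv : ideal_mul I J 'X_[(u + v)%MM].
  by apply/ideal_mul_monoP => //; exists u, v.
have := (sat_last (strongly_stable_mul sI sJ)).1 _ IJuv ltuv.
move=> /(ideal_mul_monoP _ mI mJ)[a [b [Ia Jb eqab]]].
have le1 : (U_(ord_max) <= u + v)%MM.
  by rewrite lep1mP -lt0n; apply: leq_ltn_trans ltuv.
(* The degree of [a + b] is one less than that of [u + v], although [u] and [v] have least degree in
   [I] and [J]. *)
have := leq_add (equigenerated_mdeg eI gu Ia) (equigenerated_mdeg eJ gv Jb).
by rewrite -!mdegD -eqab -{1}(submK le1) mdegD mdeg1 addn1 ltnn.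
Qed.

End LastVariable.

(** * The polynomial ring without variables *)

Section NoVariable.
Variable K : fieldType.
Implicit Types I J : set {mpoly K[0]}.

(* Without variables the irrelevant ideal is 0, so that sat 0 = 1. *)
Lemma sat_no_variable I : is_monomial I -> sat I = ~~ `[< I 'X_[0] >].
Proof.
move=> mI; have mnm0E (u : 'X_{1..0}) : u = 0%MM by apply/mnmP => -[].
have mdeg0E (u : 'X_{1..0}) : mdeg u = 0%N by rewrite (mnm0E u) mdeg0.
have sat0 : sat_at I 0 <-> I 'X_[0].
  split=> [/(sat_atP _ mI) Isat|I0]; last first.
    by apply/sat_atP => // u _ w _; rewrite (mnm0E (u + w)%MM).
  have := Isat 0%MM _ 0%MM (mdeg0E _); rewrite addm0; apply=> w.
  by rewrite mdeg0E.
have sat1 : sat_at I 1 by apply/sat_atP => // u _ w; rewrite mdeg0E.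
case: asboolP => I0 /=; first by apply: sat_eq => //; apply/sat0.
by apply: sat_eq => // -[/sat0|].
Qed.

(** Only the values 0 and 1 occur; if both summands are 0, then [I] and [J] contain 1, and so does
    their product. *)
Lemma sat_mul_no_variable I J : is_monomial I -> is_monomial J ->
  (sat (ideal_mul I J) <= sat I + sat J)%N.
Proof.
move=> mI mJ; rewrite !sat_no_variable //; last exact: is_monomial_mul.
have [I0|_] := asboolP (I 'X_[0]); last by case: asboolP.
have [J0|_] := asboolP (J 'X_[0]); last by case: asboolP.
case: asboolP => // -[]; apply/ideal_mul_monoP => //.
by exists 0%MM, 0%MM; rewrite addm0.
Qed.

Lemma sat_no_variable_neq0 I : is_monomial I -> I <> [set 0] -> sat I = 0%N.
Proof.
move=> mI /(monomial_neq0 mI)[u]; have -> : u = 0%MM by apply/mnmP => -[].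
by rewrite sat_no_variable //; case: asboolP.
Qed.

End NoVariable.

(** Equality is claimed for nonzero ideals: the zero ideal is vacuously equigenerated, and in at
    least one variable its product with [J] has saturation number 0 while [sat J] can be positive.
    The case [n = 0], which has no last variable, is treated apart. *)
Theorem corollary1p3 (K : fieldType) (n : nat) (I J : set {mpoly K[n]})
    (HI : strongly_stable I) (HJ : strongly_stable J) :
  [/\ strongly_stable (ideal_mul I J),
      (sat (ideal_mul I J) <= sat I + sat J)%N
    & I <> [set 0] -> J <> [set 0] -> equigenerated I -> equigenerated J ->
      sat (ideal_mul I J) = (sat I + sat J)%N].
Proof.
have le_sat : (sat (ideal_mul I J) <= sat I + sat J)%N.
  case: n => [|n] in I J HI HJ *; last exact: sat_mul_le.
  by apply: sat_mul_no_variable; [case: HI|case: HJ].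
split=> //; first exact: strongly_stable_mul.
move=> In0 Jn0 eI eJ; apply/eqP; rewrite eqn_leq le_sat /=.
case: n => [|n] in I J HI HJ In0 Jn0 eI eJ {le_sat} *; last exact: sat_mul_ge.
have [[mI _] [mJ _]] := (HI, HJ).
by rewrite (sat_no_variable_neq0 mI) // (sat_no_variable_neq0 mJ).
Qed.
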